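(* Let $D$ be a triply even code of length $n$. Fix a codeword $x\in D$ of weight $m_1$ with $0<m_1<n$. Let $S_1=\operatorname{supp}(\mathbf 1+x)$ and $S_2=\operatorname{supp}(x)$, and let $C_i$ and $R_i$ be the punctured code and the shortened code of $D$ on $S_i$, respectively, for $i=1,2$. Then $C_i$ is doubly even and $R_i\subset C_i\cap\operatorname{Rad}C_i$ for $i=1,2$, and $D$ is equivalent to $D(C_1,C_2,R_1,R_2,f)$ for some $f\in\Phi(C_1/R_1,C_2/R_2)$. Moreover, if $D$ is a maximal triply even code, then $\operatorname{Rad}C_i=R_i$ for $i=1,2$.
   Context: A code of length $n$ is a linear subspace of $\mathbb{F}_2^n$. $\operatorname{supp}(u)$ is the set of coordinates where $u$ is $1$ and $\operatorname{wt}(u)=|\operatorname{supp}(u)|$. $\mathbf 1$ is the all-ones vector. A code is doubly even (resp. triply even) if every codeword has weight divisible by $4$ (resp. $8$). A triply even code is maximal if it is not contained in any larger triply even code of the same length. Two codes of length $n$ are equivalent if one is obtained from the other by a permutation of the coordinates. $C^\perp$ is the dual with respect to the standard inner product. $u\ast v$ is the vector with support $\operatorname{supp}(u)\cap\operatorname{supp}(v)$. $(u|v)$ denotes concatenation. For a set $S$ of coordinates, let $\pi$ and $\pi'$ be the projections of $\mathbb{F}_2^n$ to the coordinates in $S$ and to the coordinates not in $S$, respectively. The punctured code of $C$ on $S$ is $\pi'(C)$ and the shortened code of $C$ on $S$ is $\{\pi'(c)\mid c\in C,\ \pi(c)=\mathbf 0\}$. For a doubly even code $C$ define $B:C\times C^\perp\to\mathbb{F}_2$,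 $B(v,u)=\frac{\operatorname{wt}(v\ast u)}{2}\bmod 2$; $\operatorname{rad}C=\{y\in C^\perp\mid B(x,y)=0\ \text{for all } x\in C\}$; $\operatorname{Rad}C=\{x\in\operatorname{rad}C\mid \operatorname{wt}(x)\equiv0\pmod 8\}$. For doubly even codes $C_1,C_2$ and linear subcodes $R_i\subset C_i\cap\operatorname{Rad}C_i$, an isometry is a bijective linear map $f:C_1/R_1\to C_2/R_2$ such that $\operatorname{wt}(x_1)\equiv\operatorname{wt}(x_2)\pmod 8$ for any $x_1+R_1\in C_1/R_1$ and any $x_2\in C_2$ with $x_2+R_2=f(x_1+R_1)$. The set of isometries is $\Phi(C_1/R_1,C_2/R_2)$. For $f\in\Phi(C_1/R_1,C_2/R_2)$, $$D(C_1,C_2,R_1,R_2,f)=\{(x_1|x_2)\mid x_1\in C_1,\ x_2\in f(x_1+R_1)\}.$$ *)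

(* Defs.v *)
From HB Require Import structures.
From mathcomp Require Import all_boot all_algebra.

Set Implicit Arguments.
Unset Strict Implicit.
Unset Printing Implicit Defensive.

Import GRing.Theory.
Local Open Scope ring_scope.

(* The quotient vector space vT / U, on top of the additive quotient of
   ring_quotient. *)
Section VectorQuotient.
Local Open Scope quotient_scope.
Variables (F : fieldType) (vT : vectType F) (U : {vspace vT}).

Definition vquot := Quotient.quot (pred_of_vspace U).

HB.instance Definition _ := Choice.on vquot.
HB.instance Definition _ := EqQuotient.on vquot.
HB.instance Definition _ := GRing.Zmodule.on vquot.

Lemma vquot_eq (x y : vT) :
  (\pi_vquot x = \pi_vquot y) <-> (x - y \in U).
Proof. by rewrite (Quotient.idealrBE (pred_of_vspace U)); split=> /eqP. Qed.

Lemma vquot_piD (x y : vT) : \pi_vquot (x + y) = \pi_vquot x + \pi_vquot y.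
Proof. exact: (Quotient.pi_add (pred_of_vspace U)). Qed.

Definition vquot_scale (a : F) (q : vquot) : vquot := \pi_vquot (a *: repr q).

Lemma vquot_scale_pi a (x : vT) :
  vquot_scale a (\pi_vquot x) = \pi_vquot (a *: x).
Proof.
apply/vquot_eq; rewrite -scalerBr memvZ //.
by apply/vquot_eq; rewrite reprK.
Qed.

Fact vquot_scaleA a b q :
  vquot_scale a (vquot_scale b q) = vquot_scale (a * b) q.
Proof.
elim/quotW: q => x.
by rewrite (vquot_scale_pi b) (vquot_scale_pi a) vquot_scale_pi scalerA.
Qed.

Fact vquot_scale1 : left_id 1 vquot_scale.
Proof. by elim/quotW=> x; rewrite vquot_scale_pi scale1r. Qed.

Fact vquot_scaleDr : right_distributive vquot_scale +%R.
Proof.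
move=> a; elim/quotW=> x; elim/quotW=> y; rewrite -vquot_piD.
by rewrite (vquot_scale_pi a) scalerDr vquot_piD !(vquot_scale_pi a).
Qed.

Fact vquot_scaleDl q : {morph vquot_scale^~ q : a b / a + b}.
Proof.
elim/quotW: q => x a b.
by rewrite !(vquot_scale_pi _ x) scalerDl vquot_piD.
Qed.

HB.instance Definition _ := GRing.Zmodule_isLmodule.Build F vquot
  vquot_scaleA vquot_scale1 vquot_scaleDr vquot_scaleDl.

Lemma vquot_piZ a (x : vT) : \pi_vquot (a *: x) = a *: \pi_vquot x.
Proof. by rewrite -vquot_scale_pi. Qed.

End VectorQuotient.

Notation code n := {vspace 'rV['F_2]_n}.

Section Vectors.
Variable n : nat.
Implicit Types (u v : 'rV['F_2]_n) (S : {set 'I_n}).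

Definition ones : 'rV['F_2]_n := const_mx 1.

Definition supp u : {set 'I_n} := [set i | u 0 i == 1].

Definition wt u : nat := #|supp u|.

Definition vmeet u v : 'rV['F_2]_n := \row_i (i \in supp u :&: supp v)%:R.

(* The coordinates in S are renumbered increasingly from 0 to #|S| - 1. *)
Definition proj S : 'rV['F_2]_n -> 'rV['F_2]_#|S| :=
  colsub (fun j : 'I_#|S| => enum_val j).

HB.instance Definition _ S :=
  GRing.Linear.copy (proj S) (colsub (fun j : 'I_#|S| => enum_val j)).

End Vectors.

Section Codes.
Variable n : nat.
Implicit Types (C D : code n) (S : {set 'I_n}).

Definition doubly_even C := forall c, c \in C -> (4 %| wt c)%N.

Definition triply_even C := forall c, c \in C -> (8 %| wt c)%N.

Definition maximal_triply_even D :=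
  triply_even D /\ forall D', triply_even D' -> (D <= D')%VS -> D' = D.

Definition punctured S D : code #|~: S| := (linfun (proj (~: S)) @: D)%VS.

Definition shortened S D : code #|~: S| :=
  (linfun (proj (~: S)) @: (D :&: lker (linfun (proj S))))%VS.

Lemma puncturedP S D w :
  w \in punctured S D <-> exists2 c, c \in D & w = proj (~: S) c.
Proof.
split=> [/memv_imgP[c cD ->] | [c cD ->]]; first by exists c; rewrite ?lfunE.
by apply/memv_imgP; exists c; rewrite ?lfunE.
Qed.

Lemma shortenedP S D w :
  w \in shortened S D <->
  exists c, [/\ c \in D, proj S c = 0 & w = proj (~: S) c].
Proof.
split=> [/memv_imgP[c] | [c [cD c0 ->]]].
  rewrite memv_cap memv_ker lfunE => /andP[cD /eqP c0] ->.
  by exists c; rewrite lfunE.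
by apply/memv_imgP; exists c; rewrite ?memv_cap ?memv_ker ?lfunE ?cD //= c0.
Qed.

Definition dual_code C : {set 'rV['F_2]_n} :=
  [set u : 'rV['F_2]_n | [forall v in C, \sum_i v 0 i * u 0 i == 0]].

(* Only meaningful for v in C and u in dual_code C, so that the halved weight is
   even. *)
Definition Bform (v u : 'rV['F_2]_n) : 'F_2 := (wt (vmeet v u) %/ 2)%:R.

(* rad and Rad are sets, not subspaces: Bform need not be additive in its
   second argument. *)
Definition rad C : {set 'rV['F_2]_n} :=
  [set y in dual_code C | [forall x in C, Bform x y == 0]].

Definition Rad C : {set 'rV['F_2]_n} :=
  [set x in rad C | (wt x == 0 %[mod 8])%N].

(* C / R, for R a subcode of C; the class x + R is code_coset R x, with
   x : subvs_of C. *)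
Definition code_quot C (R : code n) : lmodType 'F_2 :=
  vquot (linfun (vsval : subvs_of C -> _) @^-1: R)%VS.

Definition code_coset C (R : code n) (x : subvs_of C) : code_quot C R :=
  (\pi_(vquot (linfun (vsval : subvs_of C -> _) @^-1: R)%VS) x)%qT.

Fact code_coset_is_linear C R : linear (@code_coset C R).
Proof. by move=> a x y; rewrite /code_coset vquot_piD vquot_piZ. Qed.

HB.instance Definition _ C R :=
  GRing.isLinear.Build _ _ _ _ (@code_coset C R) (@code_coset_is_linear C R).

Lemma code_coset_eq C R (x y : subvs_of C) :
  (code_coset R x = code_coset R y) <-> (vsval x - vsval y \in R).
Proof.
by apply: (iff_trans (vquot_eq _ _ _)); rewrite -memv_preim lfunE raddfB.
Qed.

End Codes.

(* A bijection between the coordinates forces n1 = n2. *)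
Definition code_equivalent n1 n2 (C1 : code n1) (C2 : code n2) :=
  exists2 s : 'I_n2 -> 'I_n1, bijective s &
    C2 = (linfun (fun u : 'rV['F_2]_n1 => colsub s u) @: C1)%VS.

Section Gluing.
Variables (n1 n2 : nat) (C1 R1 : code n1) (C2 R2 : code n2).
Implicit Type f : {linear code_quot C1 R1 -> code_quot C2 R2}.

Definition code_isometry f :=
  bijective f /\
  forall (x1 : subvs_of C1) (x2 : subvs_of C2),
    code_coset R2 x2 = f (code_coset R1 x1) ->
    (wt (vsval x1) = wt (vsval x2) %[mod 8])%N.

(* The code D(C1, C2, R1, R2, f), as the span of a set of words that is
   already a subspace; see glueP. *)
Definition glue f : code (n1 + n2) :=
  <<enum [set u : 'rV['F_2]_(n1 + n2) |
     [&& lsubmx u \in C1, rsubmx u \in C2 &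
         code_coset R2 (vsproj C2 (rsubmx u)) ==
           f (code_coset R1 (vsproj C1 (lsubmx u)))]]>>%VS.

Lemma glueP f u :
  u \in glue f <->
  exists (x1 : subvs_of C1) (x2 : subvs_of C2),
    code_coset R2 x2 = f (code_coset R1 x1) /\ u = row_mx (vsval x1) (vsval x2).
Proof.
rewrite /glue; set A := [set u | _].
have inA w : w \in A <-> exists (x1 : subvs_of C1) (x2 : subvs_of C2),
    code_coset R2 x2 = f (code_coset R1 x1) /\ w = row_mx (vsval x1) (vsval x2).
  rewrite inE; split=> [/and3P[w1 w2 /eqP fw] | [x1 [x2 [fx ->]]]].
    exists (vsproj C1 (lsubmx w)), (vsproj C2 (rsubmx w)); split=> //.
    by rewrite !vsprojK // hsubmxK.
  by rewrite row_mxKl row_mxKr !subvsP !vsvalK fx eqxx.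
apply: iff_trans (inA u).
split=> [|uA]; last by apply: memv_span; rewrite mem_enum.
have A0 : 0 \in A.
  by apply/inA; exists 0, 0; rewrite row_mx0 !raddf0.
have AD v w : v \in A -> w \in A -> v + w \in A.
  move=> /inA[x1 [x2 [fx ->]]] /inA[y1 [y2 [fy ->]]].
  apply/inA; exists (x1 + y1), (x2 + y2); split; last by rewrite add_row_mx.
  by rewrite !raddfD /= fx fy.
have AZ (a : 'F_2) w : w \in A -> a *: w \in A.
  move=> /inA[x1 [x2 [fx ->]]].
  apply/inA; exists (a *: x1), (a *: x2); split; last by rewrite scale_row_mx.
  by rewrite !linearZ /= fx.
rewrite -[enum A]/(tval (in_tuple (enum A))) => /coord_span ->.
apply: (big_ind (fun w => w \in A)) => // i _; apply: AZ.
by rewrite -mem_enum mem_nth.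
Qed.

End Gluing.

(* Main.v *)
From HB Require Import structures.
Require Import Defs.
From mathcomp Require Import all_boot all_algebra.

Set Implicit Arguments.
Unset Strict Implicit.
Unset Printing Implicit Defensive.

Import GRing.Theory.
Local Open Scope ring_scope.

(** Everything rests on one count: [wt (u + v) + 2 wt (u * v) = wt u + wt v].
    It shows that any two words of a triply even code [D] overlap in a multiple
    of 4 coordinates.  Overlapping with [x] itself, the two restrictions of a
    word of [D], to [supp x] and to its complement, have weights divisible by
    4, and these weights sum to a multiple of 8.

    The condition defining [rad C] likewise says that a word overlaps every
    word of [C] in a multiple of 4 coordinates ([radP]).  Let [S] be any set of
    coordinates.  A word of [D] that vanishes on [S] has the same overlaps with
    [D] before and after [S] is deleted, so it yields a word of [Rad]
    ([shortened_sub_Rad]).  Conversely a word of [Rad] of the punctured code,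
    padded with zeros on [S], can be added to [D] without losing triple
    evenness; if [D] is maximal the padded word lies in [D], so the word
    itself is in the shortened code ([Rad_sub_shortened]).

    For the gluing, let [S1] and [S2] be complementary, and let [ci] be what
    remains of a word [c] of [D] once the coordinates in [Si] are deleted.  Then
    [c] is the pair of [c1] and [c2], and [c1] determines [c2] up to words of
    [D] supported off [S2], that is up to [R2]; symmetrically for [c2].  Hence [c1 + R1 |-> c2 + R2] is a well-defined linear bijection
    ([transfer]) whose graph is exactly [D] ([transfer_graph]).  Since
    [wt c1 + wt c2] is divisible by 8 and [wt c2] by 4, [wt c1] and [wt c2]
    agree modulo 8. *)

(** * Weights over the two-element field *)

Lemma F2_natE (a : 'F_2) : a = (a == 1)%:R.
Proof. by case: a => [[|[|m]] lt_m] //; apply: val_inj. Qed.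

Lemma F2_nat_eq0 k : (k%:R == 0 :> 'F_2) = (2 %| k)%N.
Proof. by rewrite -(dvdn_pcharf (pchar_Fp (isT : prime 2))). Qed.

Section Weights.
Variable n : nat.
Implicit Types (u v : 'rV['F_2]_n) (S : {set 'I_n}).

Lemma row_suppE u i : u 0 i = (i \in supp u)%:R.
Proof. by rewrite inE [LHS]F2_natE. Qed.

Lemma supp_nat S : supp (\row_i (i \in S)%:R) = S.
Proof. by apply/setP => i; rewrite inE mxE; case: (i \in S). Qed.

Lemma supp_vmeet u v : supp (vmeet u v) = supp u :&: supp v.
Proof. exact: supp_nat. Qed.

Lemma suppD u v :
  supp (u + v) = (supp u :|: supp v) :\: (supp u :&: supp v).
Proof.
apply/setP => i; rewrite !inE mxE !row_suppE.
by case: (i \in supp u); case: (i \in supp v).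
Qed.

Lemma supp_onesD u : supp (ones n + u) = ~: supp u.
Proof.
apply/setP => i; rewrite suppD !inE mxE eqxx /=.
by case: (u 0 i == 1).
Qed.

Lemma wtD u v : (wt (u + v) + 2 * wt (vmeet u v) = wt u + wt v)%N.
Proof.
rewrite /wt supp_vmeet suppD -cardsUI mul2n -addnn addnA; congr addn.
rewrite cardsD (setIidPr _) ?subnK //; last first.
  by apply: subset_trans (subsetIl _ _) (subsetUl _ _).
by rewrite subset_leq_card // (subset_trans (subsetIl _ _) (subsetUl _ _)).
Qed.

Lemma sum_mul_wt u v : \sum_i u 0 i * v 0 i = (wt (vmeet u v))%:R.
Proof.
rewrite /wt supp_vmeet -sum1_card natr_sum [RHS]big_mkcond /=.
apply: eq_bigr => i _; rewrite !row_suppE in_setI.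
by case: (i \in supp u); rewrite ?mul0r // mul1r; case: (i \in supp v).
Qed.

End Weights.

Section Projections.
Variable n : nat.
Implicit Types (u v : 'rV['F_2]_n) (S : {set 'I_n}).

Lemma card_proj S (A : {set 'I_n}) (B : {set 'I_#|S|}) :
  (forall j, (j \in B) = (enum_val j \in A)) -> #|B| = #|A :&: S|.
Proof.
move=> defB; rewrite -(card_imset _ (@enum_val_inj _ (mem S))).
apply: eq_card => i; rewrite inE; apply/imsetP/andP => [[j jB ->]|[iA iS]].
  by rewrite -defB jB enum_valP.
by exists (enum_rank_in iS i); rewrite ?defB enum_rankK_in.
Qed.

Lemma wt_proj S u : wt (proj S u) = #|supp u :&: S|.
Proof. by apply: card_proj => j; rewrite !inE mxE. Qed.

Lemma wt_vmeet_proj S u v :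
  wt (vmeet (proj S u) (proj S v)) = #|supp u :&: supp v :&: S|.
Proof. by rewrite /wt supp_vmeet; apply: card_proj => j; rewrite !inE !mxE. Qed.

Lemma proj_eq0 S u : (proj S u == 0) = [disjoint supp u & S].
Proof.
apply/eqP/pred0P => [u0 i|dis].
  apply/negP => /= /andP[ui iS].
  have /rowP/(_ (enum_rank_in iS i)) := u0.
  by rewrite !mxE enum_rankK_in // row_suppE ui => /eqP.
apply/rowP => j; rewrite !mxE row_suppE.
by have := dis (enum_val j); rewrite /= enum_valP andbT => ->.
Qed.

Lemma proj0_supp_sub S u : proj S u = 0 -> supp u \subset ~: S.
Proof. by move/eqP; rewrite proj_eq0 disjoints_subset. Qed.

Lemma wt_proj_setC S u : (wt (proj S u) + wt (proj (~: S) u) = wt u)%N.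
Proof. by rewrite !wt_proj -setDE cardsID. Qed.

Lemma zero_padding S (y : 'rV['F_2]_#|~: S|) :
  exists2 u, proj S u = 0 & proj (~: S) u = y.
Proof.
pose A := [set enum_val j | j in supp y].
exists (\row_i (i \in A)%:R).
  apply/eqP; rewrite proj_eq0 supp_nat disjoints_subset.
  by apply/subsetP => _ /imsetP[j _ ->]; apply: enum_valP.
apply/rowP => j; rewrite !mxE [RHS]row_suppE mem_imset //.
exact: enum_val_inj.
Qed.

End Projections.

(** * The radical, puncturing and shortening *)

(** Membership in the dual makes the overlap [k] even, and vanishing of the
    form makes [k / 2] even. *)
Lemma radP n (C : code n) y :
  reflect {in C, forall v, 4 %| wt (vmeet v y)}%N (y \in Defs.rad C).
Proof.
have dvd4 k : (4 %| k)%N = (2 %| k)%N && (2 %| k %/ 2)%N.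
  rewrite -[4%N]/(2 * 2)%N; case: (boolP (2 %| k)%N) => [k2|k2] /=.
    by rewrite dvdn_divRL.
  by apply: contraNF k2; apply: dvdn_trans.
rewrite !inE; apply: (iffP andP) => [[/forall_inP dC /forall_inP bC] v vC | H].
  by rewrite dvd4 -!F2_nat_eq0 -sum_mul_wt dC //; apply: bC.
by split; apply/forall_inP => v /H; rewrite ?sum_mul_wt dvd4 -!F2_nat_eq0;
  case/andP.
Qed.

Lemma RadP n (C : code n) y :
  reflect ({in C, forall v, 4 %| wt (vmeet v y)}%N /\ (8 %| wt y)%N)
    (y \in Rad C).
Proof. by rewrite inE mod0n; apply: (iffP andP) => -[/radP]. Qed.

Section TriplyEven.
Variables (n : nat) (D : code n).
Hypothesis evD : triply_even D.
Implicit Types S : {set 'I_n}.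

Lemma triply_even_vmeet u v : u \in D -> v \in D -> (4 %| wt (vmeet u v))%N.
Proof.
move=> uD vD; rewrite -(@dvdn_pmul2l 2) //.
rewrite -(@dvdn_addr (wt (u + v)) 8) ?evD ?rpredD // wtD.
by rewrite dvdn_add ?evD.
Qed.

(** Outside [supp x] the weight of [c] is [wt c - wt (c * x)], and outside the
    complement it is [wt (c * x)]. *)
Lemma punctured_supp_doubly_even x : x \in D ->
  doubly_even (punctured (supp x) D) /\ doubly_even (punctured (~: supp x) D).
Proof.
move=> xD.
have dvd_in c : c \in D -> (4 %| wt (proj (supp x) c))%N.
  by move=> cD; rewrite wt_proj -supp_vmeet triply_even_vmeet.
split=> _ /puncturedP[c cD ->].
  rewrite -(dvdn_addr _ (dvd_in c cD)) wt_proj_setC.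
  exact: dvdn_trans (evD cD).
by rewrite setCK dvd_in.
Qed.

Lemma shortened_sub_punctured S : (shortened S D <= punctured S D)%VS.
Proof. by rewrite limgS ?capvSl. Qed.

Lemma shortened_sub_Rad S : {subset shortened S D <= Rad (punctured S D)}.
Proof.
move=> _ /shortenedP[c [cD c0 ->]]; have sc := proj0_supp_sub c0.
apply/RadP; split=> [_ /puncturedP[d dD ->]|].
  rewrite wt_vmeet_proj -setIA (setIidPl sc) -supp_vmeet.
  exact: triply_even_vmeet.
by rewrite wt_proj (setIidPl sc); apply: evD.
Qed.

(** By [wtD], [wt (d + y)] differs from [wt d + wt y] by twice an overlap
    divisible by 4. *)
Lemma triply_even_addv_line y : (8 %| wt y)%N ->
    {in D, forall d, 4 %| wt (vmeet d y)}%N ->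
  triply_even (D + <[y]>)%VS.
Proof.
move=> y8 y4 _ /memv_addP[d dD [_ /vlineP[a ->] ->]].
rewrite [a]F2_natE; case: (a == 1); last by rewrite scale0r addr0 evD.
rewrite scale1r -(@dvdn_addl (2 * wt (vmeet d y))).
  by rewrite wtD dvdn_add // evD.
by rewrite -[8%N]/(2 * 4)%N dvdn_pmul2l ?y4.
Qed.

End TriplyEven.

Lemma Rad_sub_shortened n (D : code n) (S : {set 'I_n}) :
  maximal_triply_even D -> {subset Rad (punctured S D) <= shortened S D}.
Proof.
move=> [evD maxD] y /RadP[y4 y8].
have [u u0 defy] := zero_padding y; have su := proj0_supp_sub u0.
suff evDu : triply_even (D + <[u]>)%VS.
  apply/shortenedP; exists u; split=> //.
  rewrite -(maxD _ evDu (addvSl _ _)).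
  exact: subvP (addvSr _ _) _ (memv_line u).
apply: triply_even_addv_line => // [|d dD].
  by move: y8; rewrite -defy wt_proj (setIidPl su).
have /y4: proj (~: S) d \in punctured S D by apply/puncturedP; exists d.
by rewrite -defy wt_vmeet_proj -setIA (setIidPl su) -supp_vmeet.
Qed.

(** * Gluing along complementary sets of coordinates *)

Section Transfer.
Variables (n : nat) (D : code n).
Implicit Types (S : {set 'I_n}) (c : 'rV['F_2]_n).

Definition punctured_word S c : subvs_of (punctured S D) :=
  vsproj (punctured S D) (proj (~: S) c).

Definition punctured_coset S c : code_quot (punctured S D) (shortened S D) :=
  code_coset (shortened S D) (punctured_word S c).

(** The class of [c2] for some [c] in [D] with [c1] in the class [q], where
    [ci] is [c] with [Si] deleted; [transferE] shows that, for complementary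
    sets, the choice of [c] is immaterial.  Every class comes from [D], so the
    default value 0 is never reached.  Stating it for any [S1] and [S2] lets the
    inverse be the same map with the two sets exchanged. *)
Definition transfer S1 S2 (q : code_quot (punctured S1 D) (shortened S1 D)) :
    code_quot (punctured S2 D) (shortened S2 D) :=
  punctured_coset S2 (odflt 0 [pick c in D | punctured_coset S1 c == q]).

Lemma val_punctured_word S c :
  c \in D -> vsval (punctured_word S c) = proj (~: S) c.
Proof. by move=> cD; rewrite vsprojK //; apply/puncturedP; exists c. Qed.

Lemma punctured_wordP S (w : subvs_of (punctured S D)) :
  exists2 c, c \in D & w = punctured_word S c.
Proof.
have /puncturedP[c cD defw] := subvsP w; exists c => //.
by apply: val_inj; rewrite /= val_punctured_word.
Qed.

Lemma punctured_coset_is_linear S : linear (punctured_coset S).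
Proof. by move=> a c d; rewrite /punctured_coset /punctured_word !linearP. Qed.

HB.instance Definition _ S :=
  GRing.isLinear.Build _ _ _ _ (punctured_coset S) (punctured_coset_is_linear S).

Lemma punctured_cosetP S (q : code_quot (punctured S D) (shortened S D)) :
  exists2 c, c \in D & q = punctured_coset S c.
Proof.
elim/quotW: q => w; have [c cD ->] := punctured_wordP w.
by exists c.
Qed.

Lemma punctured_coset_eq S c d : c \in D -> d \in D ->
  punctured_coset S c = punctured_coset S d <->
  exists2 e, e \in D & proj S e = 0 /\ proj (~: S) (c - d) = proj (~: S) e.
Proof.
move=> cD dD; apply: iff_trans (code_coset_eq _ _ _) _.
rewrite !val_punctured_word // -raddfB.
split=> [/shortenedP[e [eD e0 ce]] | [e eD [e0 ce]]]; first by exists e.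
by apply/shortenedP; exists e.
Qed.

End Transfer.

Section Complementary.
Variables (n : nat) (D : code n) (S1 S2 : {set 'I_n}).
Hypothesis compl : S2 = ~: S1.

(** If [c - d] agrees outside [S1] with a word [e] of [D] vanishing on [S1],
    then [c - d - e] lies in [D], vanishes on [S2], and agrees with [c - d]
    outside [S2]. *)
Lemma punctured_coset_compl c d : c \in D -> d \in D ->
  punctured_coset D S1 c = punctured_coset D S1 d ->
  punctured_coset D S2 c = punctured_coset D S2 d.
Proof.
move=> cD dD /(punctured_coset_eq _ cD dD)[e eD [e0 ce]].
apply/punctured_coset_eq=> //; exists (c - d - e); first by rewrite !rpredB.
rewrite compl setCK; split; first by rewrite linearB /= ce subrr.
by rewrite [RHS]linearB /= e0 subr0.
Qed.

Lemma transferE c : c \in D ->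
  transfer S2 (punctured_coset D S1 c) = punctured_coset D S2 c.
Proof.
move=> cD; rewrite /transfer; case: pickP => [d /andP[dD /eqP]|/(_ c)] /=.
  exact: punctured_coset_compl.
by rewrite cD eqxx.
Qed.

Lemma transfer_is_linear : linear (@transfer n D S1 S2).
Proof.
move=> a q1 q2.
have [c cD ->] := punctured_cosetP q1; have [d dD ->] := punctured_cosetP q2.
by rewrite -linearP !transferE ?linearP ?rpredD ?rpredZ.
Qed.

(** If [w2] is in the class attached to [w1] by a word [c], it differs from
    [c] with [S2] deleted by some [e] in [D] vanishing on [S2]; adding [e] to
    [c] corrects the second half and leaves the first unchanged. *)
Lemma transfer_graph (w1 : subvs_of (punctured S1 D))
    (w2 : subvs_of (punctured S2 D)) :
  code_coset (shortened S2 D) w2 = transfer S2 (code_coset _ w1) <->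
  exists c, [/\ c \in D, vsval w1 = proj (~: S1) c &
                vsval w2 = proj (~: S2) c].
Proof.
split=> [|[c [cD def1 def2]]]; last first.
  have ->: w1 = punctured_word D S1 c.
    by apply: val_inj; rewrite /= val_punctured_word.
  have ->: w2 = punctured_word D S2 c.
    by apply: val_inj; rewrite /= val_punctured_word.
  by rewrite -/(punctured_coset D S1 c) transferE.
have [c cD ->] := punctured_wordP w1; have [d dD ->] := punctured_wordP w2.
rewrite -/(punctured_coset D S1 c) transferE // -/(punctured_coset D S2 d).
case/(punctured_coset_eq _ dD cD) => e eD [e0 de].
exists (c + e); split; rewrite ?rpredD ?val_punctured_word // linearD /=.
  by rewrite -compl e0 addr0.
by rewrite -de -linearD addrCA subrr addr0.
Qed.

End Complementary.

Lemma transfer_can n (D : code n) (S1 S2 : {set 'I_n}) :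
  S2 = ~: S1 -> cancel (@transfer n D S1 S2) (@transfer n D S2 S1).
Proof.
move=> compl q; have [c cD ->] := punctured_cosetP q.
by rewrite !transferE // compl setCK.
Qed.

Lemma row_mx_proj_colsub n (S1 S2 : {set 'I_n}) : S2 = ~: S1 ->
  exists2 s : 'I_(#|~: S1| + #|~: S2|) -> 'I_n, bijective s &
    forall u : 'rV['F_2]_n,
      colsub s u = row_mx (proj (~: S1) u) (proj (~: S2) u).
Proof.
move=> compl; pose s (i : 'I_(#|~: S1| + #|~: S2|)) :=
  match split i with inl j => enum_val j | inr j => enum_val j end.
exists s => [|u]; last by apply/rowP => i; rewrite !mxE /s; case: split => j;
  rewrite mxE.
apply: inj_card_bij; last first.
  by rewrite !card_ord compl setCK addnC cardsC card_ord.
have disj a : a \in ~: S1 -> a \notin ~: S2.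
  by rewrite compl setCK inE.
have neq (j : 'I_#|~: S1|) (k : 'I_#|~: S2|) : enum_val j <> enum_val k.
  by move=> jk; have := disj _ (enum_valP j); rewrite jk enum_valP.
move=> i j sij; rewrite -(splitK i) -(splitK j); move: sij; rewrite /s.
by case: (split i) => a; case: (split j) => b //;
  [move/enum_val_inj-> | move/neq | move/esym/neq | move/enum_val_inj->].
Qed.

(** The graph of [transfer] is [D] cut in two, so the glued code is [D] with its
    coordinates listed as first the complement of [S1], then that of [S2]. *)
Lemma code_equivalent_glue n (D : code n) (S1 S2 : {set 'I_n}) :
    S2 = ~: S1 -> triply_even D -> doubly_even (punctured S2 D) ->
  exists f : {linear code_quot (punctured S1 D) (shortened S1 D) ->
                     code_quot (punctured S2 D) (shortened S2 D)},
    code_isometry f /\ code_equivalent D (glue f).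
Proof.
move=> compl evD ev2.
pose f : {linear code_quot (punctured S1 D) (shortened S1 D) ->
                 code_quot (punctured S2 D) (shortened S2 D)} :=
  HB.pack (@transfer n D S1 S2)
    (GRing.isLinear.Build _ _ _ _ _ (@transfer_is_linear n D S1 S2 compl)).
exists f; split.
  split; first by exists (@transfer n D S2 S1); apply: transfer_can;
    rewrite ?compl ?setCK.
  move=> w1 w2 /(transfer_graph compl)[c [cD def1 def2]].
  have wt12 : (8 %| wt (vsval w1) + wt (vsval w2))%N.
    by rewrite def1 def2 compl setCK addnC wt_proj_setC evD.
  (* After adding [wt w2] on both sides, the two numbers are 0 and [2 wt w2]
     modulo 8. *)
  apply/eqP; rewrite -(eqn_modDr (wt (vsval w2))) (eqnP wt12) addnn -mul2n.
  by rewrite eq_sym -[8%N]/(2 * 4)%N [_ == _]dvdn_pmul2l // ev2 ?subvsP.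
have [s bij_s sE] := row_mx_proj_colsub compl; exists s => //.
apply/vspaceP => u; apply/idP/memv_imgP => [/glueP|[c cD ->]].
  case=> w1 [w2 [/(transfer_graph compl)[c [cD def1 def2]] ->]].
  by exists c; rewrite ?lfunE //= sE def1 def2.
apply/glueP; exists (punctured_word D S1 c), (punctured_word D S2 c).
rewrite lfunE /= sE !val_punctured_word //; split=> //.
by apply/(transfer_graph compl); exists c; rewrite !val_punctured_word.
Qed.

Theorem proposition22 (n m1 : nat) (D : code n) (x : 'rV['F_2]_n)
    (hD : triply_even D) (hx : x \in D) (hm1 : wt x = m1)
    (hm1n : (0 < m1 < n)%N) :
  let S1 := supp (ones n + x) in
  let S2 := supp x in
  let C1 := punctured S1 D in
  let C2 := punctured S2 D in
  let R1 := shortened S1 D in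
  let R2 := shortened S2 D in
  [/\ doubly_even C1 /\ doubly_even C2,
      ((R1 <= C1)%VS /\ {subset R1 <= Rad C1}) /\
      ((R2 <= C2)%VS /\ {subset R2 <= Rad C2}),
      exists f : {linear code_quot C1 R1 -> code_quot C2 R2},
        code_isometry f /\ code_equivalent D (glue f)
    & maximal_triply_even D -> Rad C1 =i R1 /\ Rad C2 =i R2].
Proof.
move=> S1 S2 C1 C2 R1 R2.
have compl : S2 = ~: S1 by rewrite /S1 supp_onesD setCK.
have [ev2 ev1] := punctured_supp_doubly_even hD hx.
rewrite -supp_onesD in ev1.
split=> // [||maxD].
- by do !split; rewrite ?shortened_sub_punctured //; apply: shortened_sub_Rad.
- by apply: code_equivalent_glue.
by split=> w; apply/idP/idP; do [exact: Rad_sub_shortened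
  | exact: shortened_sub_Rad].
Qed.
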